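(* Let $H_1$ and $H_2$ be vertex-disjoint simple hypergraphs, and let $u\in V(H_1)$, $v\in V(H_2)$. Then $$P_{\mathbf{U}(H_1(u)\diamond H_2(v))}(x)= P_{\mathbf{U}(H_1)}(x)\, P_{\mathbf{U}(H_2)(\{v\}|\{v\})}(x)+P_{\mathbf{U}(H_1)(\{u\}|\{u\})}(x)\,P_{\mathbf{U}(H_2)}(x)-x\,P_{\mathbf{U}(H_1)(\{u\}|\{u\})}(x)\, P_{\mathbf{U}(H_2)(\{v\}|\{v\})}(x).$$ In particular, if $u$ and $v$ are $g$-vertices (of $H_1$ and $H_2$ respectively), then $$P_{\mathbf{U}(H_1(u)\diamond H_2(v))}(x)=P_{\mathbf{U}(H_1)}(x)\, P_{\mathbf{U}(H_2\backslash \{v\})}(x)+P_{\mathbf{U}(H_1\backslash\{u\})}(x)\, P_{\mathbf{U}(H_2)}(x)-x\,P_{\mathbf{U}(H_1\backslash\{u\})}(x)\,P_{\mathbf{U}(H_2\backslash\{v\})}(x).$$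
   Context: A hypergraph $H$ consists of a finite non-empty vertex set $V(H)$ and a multiset $E(H)$ of non-empty subsets of $V(H)$, called edges. It is simple if it has no loops (edges of cardinality one) and no multiple edges. A 2-partition of a set $e$ is an unordered pair $\{S,S'\}$ of non-empty disjoint sets with $S\cup S'=e$; $S$ and $S'$ are called parts of $e$. $I(H)$ is the set of all parts of all edges of $H$ together with all singleton subsets of $V(H)$. For simple $H$, the unified matrix $\mathbf{U}(H)$ is the matrix indexed by $I(H)$ whose $(S,S')$ entry is $1$ if $\{S,S'\}$ is a 2-partition of an edge of $H$, and $0$ otherwise. The coalescence $H_1(u)\diamond H_2(v)$ is the hypergraph obtained from $H_1$ and $H_2$ by identifying $u$ with $v$. $\mathbf{U}(H)(\{w\}|\{w\})$ denotes the matrix obtained from $\mathbf{U}(H)$ by deleting the row and the column indexed by the element $\{w\}$ of $I(H)$. $P_M(x)=\det(xI-M)$ is the characteristic polynomial of $M$ (equal to $1$ for the empty matrix). A vertex $w$ of $H$ is a $g$-vertex if $w\notin e$ for every $e\in E(H)$ with $|e|>2$. $H\backslash\{w\}$ is the hypergraph obtained from $H$ by deleting the vertex $w$ and all edges containing $w$. *)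

(* Defs.v *)
From HB Require Import structures.
From mathcomp Require Import all_boot all_order all_algebra.
From mathcomp Require Import finmap multiset.

Set Implicit Arguments.
Unset Strict Implicit.
Unset Printing Implicit Defensive.

Import GRing.Theory.
Local Open Scope ring_scope.

(* Hypergraphs are subobjects of an arbitrary finite universe T, so that      *)
(* vertex-disjointness and vertex deletion are literal set operations.        *)
(* The vertex set may be empty: H \ {w} has no vertex when V(H) = {w}, and    *)
(* its unified matrix is then the empty matrix. A hypergraph with a           *)
(* distinguished vertex has a non-empty vertex set.                           *)
Record hypergraph (T : finType) := Hypergraph {
  hvert : {set T};
  hedge : {mset {set T}}%mset;
  hedgeP : forall e, e \in hedge -> e != set0 /\ e \subset hvert
}.

Section Hypergraphs.
Variable T : finType.
Implicit Types (H : hypergraph T) (e S : {set T}) (u v w : T).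

Definition simple_hypergraph H : Prop :=
  (forall e, e \in hedge H -> #|e| != 1%N) /\
  (forall e, (hedge H e <= 1)%N).

Definition two_partition e S S' : bool :=
  [&& S != set0, S' != set0, [disjoint S & S'] & S :|: S' == e].

Definition edge_part H S : bool :=
  [exists e, [exists S', (e \in hedge H) && two_partition e S S']].

(* I(H) *)
Definition uindex H : {set {set T}} :=
  [set S | edge_part H S] :|: [set [set w] | w in hvert H].

Lemma set1_uindex H w : w \in hvert H -> [set w] \in uindex H.
Proof. by move=> wV; rewrite inE imset_f ?orbT. Qed.

Definition unified_mx (R : comNzRingType) H : 'M[R]_#|uindex H| :=
  \matrix_(i, j)
    [exists e, (e \in hedge H) && two_partition e (enum_val i) (enum_val j)]%:R.

Definition vertex_index H w (wV : w \in hvert H) : 'I_#|uindex H| :=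
  enum_rank_in (set1_uindex wV) [set w].

(* U(H)({w}|{w}) *)
Definition unified_mx_del (R : comNzRingType) H w (wV : w \in hvert H) :
    'M[R]_(#|uindex H|.-1) :=
  row' (vertex_index wV) (col' (vertex_index wV) (unified_mx R H)).

Definition g_vertex H w : Prop :=
  w \in hvert H /\ forall e, e \in hedge H -> (2 < #|e|)%N -> w \notin e.

Lemma hdelete_subproof H w e :
  e \in seq_mset [seq e : {set T} <- hedge H | w \notin e] ->
  e != set0 /\ e \subset hvert H :\ w.
Proof.
rewrite (perm_mem (perm_eq_seq_mset _)) mem_filter => /andP[we /hedgeP[e0 eV]].
by split=> //; rewrite subsetD1 eV.
Qed.

Definition hdelete H w : hypergraph T := Hypergraph (@hdelete_subproof H w).

(* The vertex obtained by identifying u with v is represented by u. *)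
Definition identify u v (x : T) : T := if x == v then u else x.

Lemma coalescence_subproof H1 H2 u v e :
  e \in seq_mset [seq identify u v @: (e : {set T}) | e : {set T}
                    <- (hedge H1 `+` hedge H2)%mset] ->
  e != set0 /\ e \subset identify u v @: (hvert H1 :|: hvert H2).
Proof.
rewrite (perm_mem (perm_eq_seq_mset _)) => /mapP[f f12 ->].
have [f0 fV] : f != set0 /\ f \subset hvert H1 :|: hvert H2.
  move: f12; rewrite in_msetD => /orP[] /hedgeP[f0 fV]; split=> //.
    exact: subset_trans fV (subsetUl _ _).
  exact: subset_trans fV (subsetUr _ _).
by split; [rewrite imset_eq0 | exact: imsetS].
Qed.

(* Intended for vertex-disjoint H1 and H2, with u in H1 and v in H2. *)
Definition coalescence H1 H2 u v : hypergraph T :=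
  Hypergraph (@coalescence_subproof H1 H2 u v).

End Hypergraphs.

(* Main.v *)
Require Import Defs.
From HB Require Import structures.
From mathcomp Require Import all_boot all_order all_fingroup all_algebra.
From mathcomp Require Import finmap multiset zify.

Set Implicit Arguments.
Unset Strict Implicit.
Unset Printing Implicit Defensive.

Import GRing.Theory.
Local Open Scope ring_scope.

(** A non-empty set that lies both in V(H1) and in the image of V(H2) can only be
    {u}. Hence the index set I(G) of the coalescence G is the union of I(H1)
    and a copy of I(H2), which meet exactly in {u}
    ([uindex_coalescence], [uindex_meet]); on each half the entries of U(G) are
    those of U(H1) or U(H2), and no entry links the two halves away from {u}
    ([part_adj_coalescence_l], [part_adj_coalescence_r],
    [part_adj_coalescence_cross]). So U(G) is the adjacency matrix of two
    graphs glued at one vertex, and the formula is the classical one for such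
    a gluing.

    That formula is a statement on determinants ([pminor_coalescence]). Let a
    square matrix be indexed by c, A and B, with no entries between A and B.
    Split the row of c as (A-part, d, 0) + (0, d, B-part) - (0, d, 0), where d
    is the diagonal entry. The determinant is additive in that row, and each
    of the three resulting matrices is block triangular: the first one with
    blocks c+A and B, the second with A and c+B, the third with c and A+B.

    The second formula follows from the first because, at a g-vertex w, an
    edge containing w has at most two vertices, so that its parts are singletons.
    Deleting w therefore removes no index but {w}, and U(H \ w) is U(H) with
    the row and the column of {w} deleted ([char_poly_hdelete]).

    Determinants indexed by the elements of a finite set are expressed as
    principal minors of a function of two variables; this makes deleting,
    renaming and uniting index sets independent of how they are enumerated. *)

(** * Determinants indexed by finite sets *)

(** Two enumerations of the same index set differ by a permutation, which acts
    on rows and columns at once, so that its two signs cancel. *)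
Lemma det_reindex (K : comNzRingType) (I : eqType) (f : I -> I -> K) m n
    (h : 'I_m -> I) (k : 'I_n -> I) :
  injective h -> injective k -> codom h =i codom k ->
  \det (\matrix_(i, j) f (h i) (h j)) = \det (\matrix_(i, j) f (k i) (k j)).
Proof.
move=> hI kI hk.
have emn : m = n.
  rewrite -[m]card_ord -[n]card_ord -(size_codom h) -(size_codom k).
  by apply/perm_size/uniq_perm => //; rewrite map_inj_uniq ?enum_uniq.
case: _ / emn k kI hk => {n} k kI hk.
have kh i : h i \in codom k by rewrite -hk codom_f.
pose p i := iinv (kh i).
have kp i : k (p i) = h i by exact: f_iinv.
have pI : injective p by move=> i j e; apply: hI; rewrite -!kp e.
pose s := perm pI.
have -> : \matrix_(i, j) f (h i) (h j)
        = row_perm s (col_perm s (\matrix_(i, j) f (k i) (k j))).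
  by apply/matrixP=> i j; rewrite !mxE !permE !kp.
rewrite row_permE col_permE !det_mulmx !det_perm mulrCA.
by rewrite odd_permV -signr_addb addbb mulr1.
Qed.

Section PrincipalMinor.
Variables (K : comNzRingType) (I : finType).
Implicit Types (f g h : I -> I -> K) (A B : {set I}) (c : I).

Definition pminor f A : K :=
  \det (\matrix_(i < #|A|, j < #|A|) f (enum_val i) (enum_val j)).

Lemma det_pminor f A n (h : 'I_n -> I) : injective h -> codom h =i A ->
  \det (\matrix_(i, j) f (h i) (h j)) = pminor f A.
Proof.
move=> hI hA; apply: det_reindex => //; first exact: enum_val_inj.
move=> x; rewrite hA; apply/idP/codomP => [xA | [i ->]]; last exact: enum_valP.
by exists (enum_rank_in xA x); rewrite enum_rankK_in.
Qed.

Lemma eq_pminor f g A : {in A &, f =2 g} -> pminor f A = pminor g A.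
Proof.
move=> fg; congr (\det _); apply/matrixP=> i j.
by rewrite !mxE fg ?enum_valP.
Qed.

Lemma pminor1 f c : pminor f [set c] = f c c.
Proof.
rewrite -(@det_pminor f [set c] 1 (fun=> c)).
- by rewrite det_mx11 mxE.
- by move=> i j _; rewrite !ord1.
- move=> x; rewrite inE; apply/codomP/eqP => [[]//|->]; by exists ord0.
Qed.

(** Block triangularity: after listing A before B, the upper right block
    vanishes. *)
Lemma pminorU f A B : [disjoint A & B] ->
  (forall x y, x \in A -> y \in B -> f x y = 0) ->
  pminor f (A :|: B) = pminor f A * pminor f B.
Proof.
move=> dAB f0.
pose h (k : 'I_(#|A| + #|B|)) :=
  match split k with inl i => enum_val i | inr j => enum_val j end.
have hl i : h (lshift _ i) = enum_val i.
  by rewrite /h -[lshift _ _]/(unsplit (inl i)) unsplitK.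
have hr i : h (rshift _ i) = enum_val i.
  by rewrite /h -[rshift _ _]/(unsplit (inr i)) unsplitK.
rewrite -(@det_pminor f _ _ h).
- set M := (X in \det X); rewrite -(submxK M).
  have -> : ursubmx M = 0.
    by apply/matrixP=> i j; rewrite !mxE hl hr f0 ?enum_valP.
  rewrite det_lblock; congr (_ * _); congr (\det _); apply/matrixP=> i j;
  by rewrite !mxE ?hl ?hr.
- move=> i j; rewrite -(splitK i) -(splitK j).
  case: (split i) (split j) => [a|a] [b|b]; rewrite /= ?hl ?hr.
  + by move/enum_val_inj->.
  + by move=> e; have := disjointFr dAB (enum_valP a); rewrite e enum_valP.
  + by move=> e; have := disjointFl dAB (enum_valP a); rewrite e enum_valP.
  + by move/enum_val_inj->.
- move=> x; apply/codomP/setUP => [[k ->]|[xA|xB]].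
  + by rewrite /h; case: split => i; [left|right]; apply: enum_valP.
  + by exists (lshift _ (enum_rank_in xA x)); rewrite hl enum_rankK_in.
  + by exists (rshift _ (enum_rank_in xB x)); rewrite hr enum_rankK_in.
Qed.

Lemma pminor_rowD f g h A c : c \in A ->
  {in A, forall y, f c y = g c y + h c y} ->
  (forall x y, x != c -> g x y = f x y /\ h x y = f x y) ->
  pminor f A = pminor g A + pminor h A.
Proof.
move=> cA fc gh; pose i0 := enum_rank_in cA c.
have ci0 : enum_val i0 = c by rewrite enum_rankK_in.
have ne i : enum_val (lift i0 i) != c.
  by rewrite -ci0 (inj_eq enum_val_inj) eq_sym neq_lift.
rewrite -[pminor g A]mul1r -[pminor h A]mul1r.
apply: (@determinant_multilinear _ _ _ _ _ i0); apply/matrixP=> i j.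
- by rewrite !mxE !ci0 !mul1r fc ?enum_valP.
- by rewrite !mxE; case: (gh _ (enum_val j) (ne i)).
- by rewrite !mxE; case: (gh _ (enum_val j) (ne i)).
Qed.

(** The determinantal core of the coalescence formula: c is the only index
    through which A and B communicate. *)
Lemma pminor_coalescence f A B c : c \notin A -> c \notin B ->
  [disjoint A & B] ->
  (forall x y, x \in A -> y \in B -> f x y = 0 /\ f y x = 0) ->
  pminor f (c |: (A :|: B)) =
    pminor f (c |: A) * pminor f B + pminor f A * pminor f (c |: B)
    - f c c * pminor f A * pminor f B.
Proof.
move=> cA cB dAB f0.
have AB x : x \in A -> x \in B = false by exact: disjointFr.
have BA x : x \in B -> x \in A = false by exact: disjointFl.
have Ac x : x \in A -> (x == c) = false.
  by move=> xA; apply: contraNF cA => /eqP<-.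
have Bc x : x \in B -> (x == c) = false.
  by move=> xB; apply: contraNF cB => /eqP<-.
have dcU (X Y : {set I}) : c \notin Y -> [disjoint X & Y] ->
    [disjoint c |: X & Y].
  by move=> cY XY; rewrite -setI_eq0 setIUl setU_eq0 !setI_eq0 disjoints1 cY.
(* The three terms come from keeping, in row c, the columns c and A, the
   columns c and B, or the column c alone. *)
pose keep (P : pred I) x y := if (x == c) && ~~ P y then 0 else f x y.
have keepE (P : pred I) (X : {set I}) :
    (forall y, y \in X -> c \in X -> P y) ->
    pminor (keep P) X = pminor f X.
  move=> PX; apply: eq_pminor => x y xX yX; rewrite /keep.
  by case: eqP => //= xc; rewrite PX // -xc.
have split_row (P Q : pred I) : (forall y, ~~ (P y && Q y)) ->
    pminor (keep (predU P Q)) (c |: (A :|: B))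
    = pminor (keep P) (c |: (A :|: B)) + pminor (keep Q) (c |: (A :|: B)).
  move=> PQ; apply: (@pminor_rowD _ _ _ _ c); first exact: setU11.
    move=> y _; rewrite /keep eqxx /=; have := PQ y.
    by case: (P y); case: (Q y); rewrite ?addr0 ?add0r.
  by move=> x y /negPf xc; rewrite /keep xc.
have e1 : pminor (keep (mem (c |: A))) (c |: (A :|: B))
        = pminor f (c |: A) * pminor f B.
  rewrite setUA pminorU.
  - rewrite !keepE // => y yB; first by rewrite (negPf cB).
  - by rewrite dcU.
  - move=> x y; rewrite /keep !inE => /orP[/eqP->|xA] yB.
      by rewrite eqxx (BA y) // Bc.
    by rewrite (Ac x) //=; case: (f0 x y).
have e2 : pminor (keep (mem (c |: B))) (c |: (A :|: B))
        = pminor f A * pminor f (c |: B).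
  rewrite (setUC A) setUA pminorU.
  - rewrite mulrC !keepE // => y yB; by rewrite (negPf cA).
  - by rewrite dcU // disjoint_sym.
  - move=> x y; rewrite /keep !inE => /orP[/eqP->|xA] yB.
      by rewrite eqxx (AB y) // Ac.
    by rewrite (Bc x) //=; case: (f0 y x).
have e3 : pminor (keep (pred1 c)) (c |: (A :|: B))
        = f c c * pminor f A * pminor f B.
  rewrite pminorU ?pminorU.
  - rewrite pminor1 !keepE ?mulrA /keep /= ?eqxx // => y yB.
      by rewrite (negPf cB).
    by rewrite (negPf cA).
  - by [].
  - by move=> x y xA yB; rewrite /keep Ac //; case: (f0 x y).
  - by rewrite disjoints1 inE negb_or cA.
  - move=> x y /set1P-> yAB; rewrite /keep eqxx /=.
    by case: eqP yAB => // ->; rewrite inE (negPf cA) (negPf cB).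
rewrite -e1 -e2 -e3.
(* The row of c restricted to B is added both to (A-part, d, 0), giving the
   whole row, and to (0, d, 0), giving (0, d, B-part). *)
have -> : pminor f (c |: (A :|: B))
   = pminor (keep (predU (mem (c |: A)) (mem B))) (c |: (A :|: B)).
  rewrite keepE // => y; by rewrite !inE orbA.
have -> : pminor (keep (mem (c |: B))) (c |: (A :|: B))
   = pminor (keep (predU (pred1 c) (mem B))) (c |: (A :|: B)).
  apply: eq_pminor => x y _ _; rewrite /keep.
  congr (if _ && ~~ _ then _ else _).
  by rewrite /= !inE.
rewrite !split_row.
- by rewrite -[RHS]addrA [X in _ + (X - _)]addrC addrK.
- move=> y /=; case: eqP => // ->; by rewrite cB.
- move=> y /=; rewrite !inE negb_and negb_or orbC.
  by case: (boolP (y \in B)) => //= yB; rewrite Bc // BA.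
Qed.

End PrincipalMinor.

Lemma pminor_imset (K : comNzRingType) (I J : finType) (phi : J -> I)
    (f : I -> I -> K) (A : {set J}) : {in A &, injective phi} ->
  pminor f (phi @: A) = pminor (fun x y => f (phi x) (phi y)) A.
Proof.
move=> phiI; rewrite -(@det_pminor _ _ _ _ #|A| (fun i => phi (enum_val i))) //.
- by move=> i j /phiI/enum_val_inj-> //; apply: enum_valP.
- move=> x; apply/codomP/imsetP => [[i ->]|[a aA ->]] /=.
    by exists (enum_val i); first exact: enum_valP.
  by exists (enum_rank_in aA a); rewrite /= enum_rankK_in.
Qed.

(** * The unified matrix as a matrix indexed by parts *)

Section UnifiedMatrix.
Variables (T : finType).
Implicit Types (H : hypergraph T) (e S : {set T}).

Definition part_adj H S S' : bool :=
  [exists e, (e \in hedge H) && two_partition e S S'].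

(** The entries of xI - U(H), as a function of arbitrary sets: such functions
    can be compared for different hypergraphs, whose matrices differ in size. *)
Definition unified_charmx (R : comNzRingType) H S S' : {poly R} :=
  'X *+ (S == S') - ((part_adj H S S')%:R)%:P.

Lemma char_poly_unified (R : comNzRingType) H :
  char_poly (unified_mx R H) = pminor (unified_charmx R H) (uindex H).
Proof.
congr (\det _); apply/matrixP=> i j; rewrite !mxE.
by rewrite /unified_charmx (inj_eq enum_val_inj).
Qed.

Lemma char_poly_unified_del (R : comNzRingType) H w (wV : w \in hvert H) :
  char_poly (unified_mx_del R wV)
  = pminor (unified_charmx R H) (uindex H :\ [set w]).
Proof.
set i0 := vertex_index wV.
have wi0 : enum_val i0 = [set w] by rewrite enum_rankK_in ?set1_uindex.
rewrite -(@det_pminor _ _ _ _ _ (fun i => enum_val (lift i0 i))).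
- congr (\det _); apply/matrixP=> i j.
  by rewrite !mxE /unified_charmx (inj_eq enum_val_inj) (inj_eq lift_inj).
- by move=> i j /enum_val_inj/lift_inj.
- move=> S; apply/codomP/setD1P => [[i ->]|[Sw SI]].
    rewrite -wi0 (inj_eq enum_val_inj) eq_sym neq_lift; split=> //.
    exact: enum_valP.
  have ne : i0 != enum_rank_in SI S.
    by apply: contraNneq Sw => e; rewrite -wi0 e enum_rankK_in.
  by have [j ej _] := unlift_some ne; exists j; rewrite -ej enum_rankK_in.
Qed.

Lemma part_adjP H S S' :
  reflect (exists2 e, e \in hedge H & two_partition e S S') (part_adj H S S').
Proof. exact: exists_inP. Qed.

Lemma part_adj_sym H S S' : part_adj H S S' = part_adj H S' S.
Proof.
apply: eq_existsb => e; rewrite /two_partition disjoint_sym setUC.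
by congr (_ && _); apply: andbCA.
Qed.

Lemma uindexP H S : reflect
  ((exists S', part_adj H S S') \/ exists2 w, w \in hvert H & S = [set w])
  (S \in uindex H).
Proof.
rewrite in_setU inE; apply: (iffP orP) => -[Sp|Sp].
- case/existsP: Sp => e /existsP[S' Sp]; left; exists S'.
  by apply/existsP; exists e.
- by right; apply/imsetP.
- case: Sp => S' /existsP[e Sp]; left; apply/existsP; exists e.
  by apply/existsP; exists S'.
- by right; apply/imsetP.
Qed.

Lemma part_adj_uindex H S S' : part_adj H S S' -> S \in uindex H.
Proof. by move=> SS'; apply/uindexP; left; exists S'. Qed.

Lemma uindex_sub H S : S \in uindex H -> S != set0 /\ S \subset hvert H.
Proof.
case/uindexP => [[S' /part_adjP[e /hedgeP[_ eV]]]|[w wV ->]].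
  case/and4P=> S0 _ _ /eqP Se; split; first by [].
  by rewrite (subset_trans _ eV) // -Se subsetUl.
by rewrite sub1set wV; split=> //; apply/set0Pn; exists w; rewrite inE.
Qed.

Lemma two_partition_imset (phi : T -> T) e S S' :
  {in e &, injective phi} -> two_partition e S S' ->
  two_partition (phi @: e) (phi @: S) (phi @: S').
Proof.
move=> phiI /and4P[S0 S'0 dS /eqP eE]; apply/and4P; split.
- by rewrite imset_eq0.
- by rewrite imset_eq0.
- rewrite -setI_eq0 -imsetI ?(disjoint_setI0 dS) ?imset0 //.
  by move=> x y xS yS'; apply: phiI; rewrite -eE inE ?xS ?yS' ?orbT.
- by rewrite -imsetU eE.
Qed.

(** A 2-partition of an image pulls back along the map, injective or not, since
    preimages inside e are disjoint and cover e. *)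
Lemma imset_two_partition (phi : T -> T) e S S' :
  two_partition (phi @: e) S S' ->
  exists a b, [/\ two_partition e a b, S = phi @: a & S' = phi @: b].
Proof.
move=> /and4P[S0 S'0 dS /eqP eE].
have im (X : {set T}) : X \subset phi @: e -> X = phi @: (e :&: phi @^-1: X).
  move=> Xe; apply/setP=> y; apply/idP/imsetP => [yX|[x]].
    have /imsetP[x xe yx] := subsetP Xe _ yX.
    by exists x; rewrite // !inE xe -yx.
  by rewrite !inE => /andP[_ xX] ->.
have SE := im S; have S'E := im S'; rewrite -eE subsetUl subsetUr in SE S'E.
exists (e :&: phi @^-1: S), (e :&: phi @^-1: S'); split; rewrite -?SE -?S'E //.
apply/and4P; split.
- by rewrite -(imset_eq0 phi) -SE.
- by rewrite -(imset_eq0 phi) -S'E.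
- rewrite -setI_eq0; apply/eqP/setP=> x; rewrite !inE.
  by case: (x \in e) => //=; apply/negP=> /andP[/(disjointFr dS)->].
- rewrite -setIUr -preimsetU eE; apply/eqP/setIidPl/subsetP=> x xe.
  by rewrite inE imset_f.
Qed.

End UnifiedMatrix.

(** * Parts of a coalescence *)

Section Coalescence.
Variables (T : finType) (H1 H2 : hypergraph T) (u v : T).
Implicit Types (e S : {set T}).
Hypotheses (disj : [disjoint hvert H1 & hvert H2]).
Hypotheses (hu : u \in hvert H1) (hv : v \in hvert H2).

Local Notation glue := (identify u v).
Local Notation G := (coalescence H1 H2 u v).

Lemma glue_id x : x \in hvert H1 -> glue x = x.
Proof.
by rewrite /identify; case: eqP => // -> /(disjointFr disj); rewrite hv.
Qed.

Lemma glue_imset_id S : S \subset hvert H1 -> glue @: S = S.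
Proof.
move=> SV; rewrite -[RHS]imset_id; apply: eq_in_imset => x xS.
exact: glue_id (subsetP SV x xS).
Qed.

(** Sending v to u creates no collision inside H2, because u is not in V(H2). *)
Lemma glue_inj : {in hvert H2 &, injective glue}.
Proof.
have nu x : x \in hvert H2 -> x != u.
  by apply: contraTneq => ->; rewrite (disjointFr disj).
move=> x y xV yV; rewrite /identify.
case: eqP => [->|_]; case: eqP => [->|_] // e.
  by have := nu _ yV; rewrite -e eqxx.
by have := nu _ xV; rewrite e eqxx.
Qed.

Lemma glue_imset_inj S S' : S \subset hvert H2 ->
  S' \subset hvert H2 -> glue @: S = glue @: S' -> S = S'.
Proof.
move=> SV S'V e; apply/setP=> x; apply/idP/idP => xS.
  have : glue x \in glue @: S' by rewrite -e imset_f.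
  case/imsetP => y yS' /glue_inj-> //.
    exact: (subsetP SV).
  exact: (subsetP S'V).
have : glue x \in glue @: S by rewrite e imset_f.
case/imsetP => y yS' /glue_inj-> //.
  exact: (subsetP S'V).
exact: (subsetP SV).
Qed.

(** A vertex of H2 other than v is not moved, so by disjointness it stays outside
    V(H1); only the identified vertex is common to both halves. *)
Lemma sub_glued S S2 : S != set0 -> S \subset hvert H1 ->
  S2 \subset hvert H2 -> S \subset glue @: S2 -> S = [set u].
Proof.
move=> S0 SV S2V SS2; apply/eqP; rewrite eqEcard cards1 card_gt0 S0 andbT.
apply/subsetP=> x xS; have xV := subsetP SV x xS.
have /imsetP[y yS2] := subsetP SS2 x xS.
rewrite inE /identify; case: eqP => [_ ->//|_ xy].
by have := disjointFr disj xV; rewrite xy (subsetP S2V).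
Qed.

Lemma coalescence_hedge e : e \in hedge G <->
  e \in hedge H1 \/ exists2 e', e' \in hedge H2 & e = glue @: e'.
Proof.
rewrite /= (perm_mem (perm_eq_seq_mset _)); split.
  case/mapP=> f; rewrite in_msetD => /orP[fH|fH] ->; last by right; exists f.
  by left; rewrite glue_imset_id //; case/hedgeP: fH.
case=> [eH|[e' eH ->]]; last by apply: map_f; rewrite in_msetD eH orbT.
rewrite -(glue_imset_id (proj2 (hedgeP eH))).
by apply: map_f; rewrite in_msetD eH.
Qed.

Lemma part_adj_coalescence S S' : part_adj G S S' <->
  part_adj H1 S S' \/
  exists a b, [/\ part_adj H2 a b, S = glue @: a & S' = glue @: b].
Proof.
split.
  case/part_adjP=> e /coalescence_hedge[eH SS'|[e' eH ->]].
    by left; apply/part_adjP; exists e.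
  case/imset_two_partition => a [b [ab Sa Sb]]; right; exists a, b.
  by split=> //; apply/part_adjP; exists e'.
case=> [/part_adjP[e eH SS']|[a [b [/part_adjP[e eH ab] -> ->]]]].
  by apply/part_adjP; exists e => //; apply/coalescence_hedge; left.
apply/part_adjP; exists (glue @: e).
  by apply/coalescence_hedge; right; exists e.
apply: two_partition_imset => // x y xe ye.
by have [_ /subsetP eV] := hedgeP eH; apply: glue_inj; apply: eV.
Qed.

Lemma uindex_coalescence :
  uindex G = uindex H1 :|: [set glue @: (S : {set T}) | S in uindex H2].
Proof.
apply/setP=> S; rewrite in_setU; apply/uindexP/orP.
  case=> [[S' /part_adj_coalescence[SS'|[a [b [ab -> _]]]]]|[w /imsetP[x]]].
  - by left; apply: part_adj_uindex SS'.
  - by right; apply/imset_f/(part_adj_uindex ab).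
  - rewrite in_setU => /orP[xV|xV] -> ->.
      by left; rewrite glue_id // set1_uindex.
    by right; rewrite -imset_set1 imset_f // set1_uindex.
case=> [/uindexP[[S' SS']|[w wV ->]]|/imsetP[a /uindexP[[b ab]|[w wV ->]] ->]].
- by left; exists S'; apply/part_adj_coalescence; left.
- by right; exists w => //; rewrite -(glue_id wV) imset_f // inE wV.
- left; exists (glue @: b); apply/part_adj_coalescence; right.
  by exists a, b.
- by right; exists (glue w); rewrite ?imset_set1 // imset_f // inE wV orbT.
Qed.

(** The parts of an edge are disjoint. This rules out a 2-partition whose two
    parts are common to the two halves of the coalescence, since both would be
    {u}. *)
Lemma part_adj_not1 H S S' w : part_adj H S S' ->
  S = [set w] -> S' = [set w :> T] -> False.
Proof.
case/part_adjP=> e _ /and4P[_ _ + _] Sw S'w; rewrite {}Sw {}S'w.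
by rewrite disjoints1 inE eqxx.
Qed.

(** Gluing adds no entry inside I(H1): a new one would come from an edge of H2,
    and both of its parts would lie in the intersection of the halves. *)
Lemma part_adj_coalescence_l : {in uindex H1 &, part_adj G =2 part_adj H1}.
Proof.
move=> S S' /uindex_sub[S0 SV] /uindex_sub[S'0 S'V].
apply/idP/idP => [SS'|SS']; last by apply/part_adj_coalescence; left.
case/part_adj_coalescence: (SS') => // -[a [b [ab Sa Sb]]].
have [_ aV] := uindex_sub (part_adj_uindex ab).
have [_ bV] : b != set0 /\ b \subset hvert H2.
  by apply: uindex_sub; rewrite part_adj_sym in ab; apply: part_adj_uindex ab.
case: (part_adj_not1 (w := u) SS').
  by apply: sub_glued aV _; rewrite // Sa.
by apply: sub_glued bV _; rewrite // Sb.
Qed.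

Lemma part_adj_coalescence_r : {in uindex H2 &, forall S S' : {set T},
  part_adj G (glue @: S) (glue @: S') = part_adj H2 S S'}.
Proof.
move=> S S' /uindex_sub[S0 SV] /uindex_sub[S'0 S'V].
apply/idP/idP => [SS'|SS']; last first.
  by apply/part_adj_coalescence; right; exists S, S'.
case/part_adj_coalescence: (SS') => [ab|[a [b [ab Sa Sb]]]].
  have [a0 aV] := uindex_sub (part_adj_uindex ab).
  have [b0 bV] : glue @: S' != set0 /\ glue @: S' \subset hvert H1.
    by apply: uindex_sub; rewrite part_adj_sym in ab; apply: part_adj_uindex ab.
  case: (part_adj_not1 (w := u) SS').
    exact: sub_glued SV _.
  exact: sub_glued S'V _.
have [_ aV] := uindex_sub (part_adj_uindex ab).
have [_ bV] : b != set0 /\ b \subset hvert H2.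
  by apply: uindex_sub; rewrite part_adj_sym in ab; apply: part_adj_uindex ab.
by rewrite (glue_imset_inj SV aV Sa) (glue_imset_inj S'V bV Sb).
Qed.

Lemma glue_set1 : glue @: [set v] = [set u].
Proof. by rewrite imset_set1 /identify eqxx. Qed.

Lemma glue_eq_set1 S : S \in uindex H2 ->
  (glue @: S == [set u]) = (S == [set v]).
Proof.
case/uindex_sub=> _ SV; apply/eqP/eqP => [|->]; last exact: glue_set1.
by rewrite -glue_set1; apply: glue_imset_inj; rewrite ?sub1set.
Qed.

Lemma uindex_meet S S2 : S \in uindex H1 -> S2 \in uindex H2 ->
  S = glue @: S2 -> S = [set u].
Proof.
move=> /uindex_sub[S0 SV] /uindex_sub[_ S2V] e.
by apply: sub_glued S2V _; rewrite // e.
Qed.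

(** An edge of G comes from one of the two hypergraphs, so both of its parts lie
    in the same half. *)
Lemma part_adj_coalescence_cross S S2 : S \in uindex H1 :\ [set u] ->
  S2 \in uindex H2 :\ [set v] -> part_adj G S (glue @: S2) = false.
Proof.
case/setD1P=> Su SI /setD1P[S2v S2I].
apply: negbTE; apply/negP=> /part_adj_coalescence[ab|[a [b [ab Sa Sb]]]].
  rewrite part_adj_sym in ab; have bI := part_adj_uindex ab.
  by case/eqP: S2v; apply/eqP; rewrite -glue_eq_set1 // (uindex_meet bI S2I).
have aI := part_adj_uindex ab.
by case/eqP: Su; apply: uindex_meet SI aI Sa.
Qed.

Lemma char_poly_coalescence (R : comNzRingType) :
  char_poly (unified_mx R G) =
    char_poly (unified_mx R H1) * char_poly (unified_mx_del R hv)
    + char_poly (unified_mx_del R hu) * char_poly (unified_mx R H2)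
    - 'X * char_poly (unified_mx_del R hu) * char_poly (unified_mx_del R hv).
Proof.
rewrite !char_poly_unified_del !char_poly_unified.
set F := unified_charmx R G.
pose im2 := fun S : {set T} => glue @: S.
have uI1 : [set u] \in uindex H1 by apply: set1_uindex.
have vI2 : [set v] \in uindex H2 by apply: set1_uindex.
have imI : {in uindex H2 &, injective im2}.
  by move=> S S' /uindex_sub[_ SV] /uindex_sub[_ S'V]; apply: glue_imset_inj.
have left1 (A : {set {set T}}) : A \subset uindex H1 ->
    pminor (unified_charmx R H1) A = pminor F A.
  move=> /subsetP AI; apply: eq_pminor => S S' /AI SI /AI S'I.
  by rewrite /F /unified_charmx part_adj_coalescence_l.
have right2 (B : {set {set T}}) : B \subset uindex H2 ->
    pminor (unified_charmx R H2) B = pminor F (im2 @: B).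
  move=> /subsetP BI; rewrite pminor_imset; last first.
    by move=> S S' /BI SI /BI S'I; apply: imI.
  apply: eq_pminor => S S' /BI SI /BI S'I.
  by rewrite /F /unified_charmx part_adj_coalescence_r // (inj_in_eq imI).
rewrite !left1 ?subsetDl // !right2 ?subsetDl //.
set A := uindex H1 :\ [set u]; set B := im2 @: (uindex H2 :\ [set v]).
have e1 : uindex H1 = [set u] |: A by rewrite setD1K.
have e2 : im2 @: uindex H2 = [set u] |: B.
  by rewrite -(setD1K vI2) imsetU imset_set1 /im2 glue_set1.
have eG : uindex G = [set u] |: (A :|: B).
  by rewrite uindex_coalescence e1 [X in _ :|: X]e2 setUACA setUid setUA.
have eF : F [set u] [set u] = 'X.
  rewrite /F /unified_charmx eqxx; case: (boolP (part_adj _ _ _)) => [uu|_].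
    by case: (part_adj_not1 uu erefl erefl).
  by rewrite subr0.
have AB S S' : S \in A -> S' \in B -> S <> S'.
  move=> /setD1P[Su SI] /imsetP[S2 /setD1P[_ S2I] ->] e.
  by case/eqP: Su; apply: uindex_meet SI S2I e.
rewrite eG e1 e2 pminor_coalescence ?eF //.
- by rewrite /A setD11.
- apply/imsetP=> -[S2 /setD1P[S2v S2I] /esym/eqP].
  by rewrite glue_eq_set1 // (negPf S2v).
- rewrite disjoint_subset; apply/subsetP=> S SA.
  by apply/negP=> SB; case: (AB S S SA SB).
- move=> S S' SA S'B; have /eqP/negPf SS' := AB _ _ SA S'B.
  case/imsetP: S'B SS' => S2 S2I -> SS'; rewrite /F /unified_charmx.
  rewrite [im2 S2 == S]eq_sym SS' [part_adj _ (im2 _) _]part_adj_sym.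
  by rewrite part_adj_coalescence_cross // subr0.
Qed.

End Coalescence.

(** * Deletion of a g-vertex *)

Section VertexDeletion.
Variables (T : finType) (H : hypergraph T) (w : T).
Implicit Types (e S : {set T}).
Hypothesis gw : g_vertex H w.

Lemma hdelete_hedge e :
  (e \in hedge (hdelete H w)) = (e \in hedge H) && (w \notin e).
Proof. by rewrite /= (perm_mem (perm_eq_seq_mset _)) mem_filter andbC. Qed.

(** An edge at a g-vertex w has at most two vertices, so its parts are {w} and
    one other singleton. *)
Lemma g_vertex_part e S S' : e \in hedge H -> w \in e ->
  two_partition e S S' -> S != [set w] ->
  S' = [set w] /\ exists2 x, x \in hvert H :\ w & S = [set x].
Proof.
move=> eH we /and4P[S0 S'0 dS /eqP eE] Sw.
have e2 : (#|e| <= 2)%N.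
  by rewrite leqNgt; apply: contraL we; apply: (proj2 gw).
have cS : (#|S| + #|S'|)%N = #|e|.
  by rewrite -eE cardsU (disjoint_setI0 dS) cards0 subn0.
rewrite -card_gt0 in S0; rewrite -card_gt0 in S'0.
have /eqP/cards1P[x Sx] : #|S| = 1%N by lia.
have /eqP/cards1P[y Sy] : #|S'| = 1%N by lia.
have xw : x != w by apply: contraNneq Sw => <-; rewrite Sx.
have /eqP wy : w == y.
  by have := we; rewrite -eE Sx Sy !inE eq_sym (negPf xw).
split; [by rewrite Sy wy | exists x => //].
rewrite !inE xw; apply: (subsetP (proj2 (hedgeP eH))).
by rewrite -eE Sx !inE eqxx.
Qed.

Lemma part_adj_hdelete S S' : S != [set w] -> S' != [set w] ->
  part_adj (hdelete H w) S S' = part_adj H S S'.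
Proof.
move=> Sw S'w; apply/part_adjP/part_adjP => -[e]; first last.
  move=> eH ab; exists e => //; rewrite hdelete_hedge eH.
  apply: contra S'w => we.
  by case: (g_vertex_part eH we ab Sw) => ->.
by rewrite hdelete_hedge => /andP[eH _] ab; exists e.
Qed.

Lemma uindex_hdelete : uindex (hdelete H w) = uindex H :\ [set w].
Proof.
apply/setP=> S; apply/idP/setD1P => [SI|[Sw]].
  have [S0 SV] := uindex_sub SI; split.
    by apply: contraTneq SV => ->; rewrite sub1set !inE eqxx.
  case/uindexP: SI => [[S' /part_adjP[e]]|[x]].
    rewrite hdelete_hedge => /andP[eH _] ab.
    by apply/(@part_adj_uindex _ _ _ S')/part_adjP; exists e.
  by case/setD1P=> _ xV ->; apply: set1_uindex.
case/uindexP=> [[S' /part_adjP[e eH ab]]|[x xV Sx]]; apply/uindexP.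
  have [we|we] := boolP (w \in e).
    by right; case: (g_vertex_part eH we ab Sw).
  by left; exists S'; apply/part_adjP; exists e; rewrite ?hdelete_hedge ?eH.
right; exists x => //; rewrite !inE xV andbT.
by apply: contraNneq Sw => <-; rewrite Sx.
Qed.

Lemma char_poly_hdelete (R : comNzRingType) (wV : w \in hvert H) :
  char_poly (unified_mx R (hdelete H w)) = char_poly (unified_mx_del R wV).
Proof.
rewrite char_poly_unified char_poly_unified_del uindex_hdelete.
apply: eq_pminor => S S' /setD1P[Sw _] /setD1P[S'w _].
by rewrite /unified_charmx part_adj_hdelete.
Qed.

End VertexDeletion.

(** * The coalescence formulas *)

Theorem theorem8p2 (R : comNzRingType) (T : finType) (H1 H2 : hypergraph T)
    (u v : T) (disj : [disjoint hvert H1 & hvert H2])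
    (simple1 : simple_hypergraph H1) (simple2 : simple_hypergraph H2)
    (hu : u \in hvert H1) (hv : v \in hvert H2) :
  char_poly (unified_mx R (coalescence H1 H2 u v)) =
    char_poly (unified_mx R H1) * char_poly (unified_mx_del R hv)
    + char_poly (unified_mx_del R hu) * char_poly (unified_mx R H2)
    - 'X * char_poly (unified_mx_del R hu) * char_poly (unified_mx_del R hv)
  /\
  (g_vertex H1 u -> g_vertex H2 v ->
   char_poly (unified_mx R (coalescence H1 H2 u v)) =
     char_poly (unified_mx R H1) * char_poly (unified_mx R (hdelete H2 v))
     + char_poly (unified_mx R (hdelete H1 u)) * char_poly (unified_mx R H2)
     - 'X * char_poly (unified_mx R (hdelete H1 u))
          * char_poly (unified_mx R (hdelete H2 v))).
Proof.
have glued := char_poly_coalescence disj hu hv R.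
split=> // gu gv.
by rewrite (char_poly_hdelete gu R hu) (char_poly_hdelete gv R hv).
Qed.
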